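(* Let $G$ be a Lie group with two-dimensional commutator subalgebra, $g=\langle\cdot,\cdot\rangle$ a left-invariant Riemannian metric on $G$, and $\tilde g$ the natural lifted left-invariant metric on $TG$. Then for all $u,v\in\mathcal P$ the Riemann curvature tensor $\tilde R$ of $(TG,\tilde g)$ satisfies: 1) $\tilde R(e_1^c,e_2^c)e_2^c=\left(-\langle a_1,b_2\rangle+\frac14\|a_2+b_1\|^2\right)e_1^c-\frac14\left(2f_1(b_2)-f_2(a_2)-f_2(b_1)\right)^c$ 2) $\tilde R(e_1^c,e_2^v)e_2^v=\left(-\langle a_1,b_2\rangle+\frac14\|a_2\|^2\right)e_1^c-\frac14\langle 2b_1+a_2,b_2\rangle e_2^c-\frac14\left(2f_1(b_2)-f_2(a_2)\right)^c$ 3) $\tilde R(e_1^c,e_1^v)e_1^v=-\frac14\left(3\|a_1\|^2e_1^c+\langle b_1+2a_2,a_1\rangle e_2^c+(f_1(a_1))^c\right)$ 4) $\tilde R(e_1^v,e_2^v)e_2^v=\left(-\langle a_1,b_2\rangle+\frac14\|a_2+b_1\|^2\right)e_1^v-\frac14\left(2f_1(b_2)-f_2(a_2)-f_2(b_1)\right)^v$ 5) $\tilde R(e_1^v,e_2^c)e_2^c=\left(-\langle a_1,b_2\rangle+\frac14\|b_1\|^2\right)e_1^v-\frac14\langle b_1+2a_2,b_2\rangle e_2^v-\frac12(f_1(b_2))^v$ 6) $\tilde R(e_2^c,e_2^v)e_2^v=-\frac14\left(\langle 2b_1+a_2,b_2\rangle e_1^c+3\|b_2\|^2e_2^c+(f_2(b_2))^c\right)$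 7) $\tilde R(e_2^c,e_1^v)e_1^v=-\frac14\langle a_1,b_1+2a_2\rangle e_1^c+\left(\frac14\|b_1\|^2-\langle a_1,b_2\rangle\right)e_2^c+\left(\frac14f_1(b_1)-\frac12f_2(a_1)\right)^c$ 8) $\tilde R(e_2^c,e_2^v)e_2^v=-\frac14\langle b_2,a_2+2b_1\rangle e_1^c-\frac34\|b_2\|^2e_2^c-\frac14(f_2(b_2))^c$ 9) $\tilde R(e_2^v,e_2^c)e_2^c=-\frac14\langle 2a_2+b_1,b_2\rangle e_1^v-\frac34\|b_2\|^2e_2^v-\frac12(f_2(b_2))^v$ 10) $\tilde R(e_2^v,e_1^v)e_1^v=\left(\frac14\|a_2+b_1\|^2-\langle a_1,b_2\rangle\right)e_2^v+\frac14(f_1(a_2))^v+\frac14(f_1(b_1))^v-\frac12(f_2(a_1))^v$ 11) $\tilde R(e_2^v,e_1^c)e_1^c=-\frac14\langle a_1,a_2+2b_1\rangle e_1^v+\left(\frac14\|a_2\|^2-\langle a_1,b_2\rangle\right)e_2^v-\frac12(f_2(a_1))^v$ 12) $\tilde R(e_2^c,e_1^c)e_1^c=\left(-\langle a_1,b_2\rangle+\frac14\|a_2+b_1\|^2\right)e_2^c-\frac14\left(2f_2(a_1)-f_1(a_2)-f_1(b_1)\right)^c$ 13) $\tilde R(u^c,v^c)v^c=\left(\frac14\langle f_2(u),v\rangle\langle b_1+3a_2,v\rangle+\langle f_1(u),v\rangle\langle a_1,v\rangle\right)e_1^c+\left(\frac14\langle f_1(u),v\rangle\langle a_2+3b_1,v\rangle+\langle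 f_2(u),v\rangle\langle b_2,v\rangle\right)e_2^c+\frac34\left(\langle f_1(u),v\rangle f_1(v)+\langle f_2(u),v\rangle f_2(v)\right)^c$ 14) $\tilde R(u^c,v^v)v^v=\frac34\left(\langle f_1(u),v\rangle\langle a_1,v\rangle+\langle f_2(u),v\rangle\langle a_2,v\rangle\right)e_1^c+\frac34\left(\langle f_1(u),v\rangle\langle b_1,v\rangle+\langle f_2(u),v\rangle\langle b_2,v\rangle\right)e_2^c+\frac34\left(\langle f_1(u),v\rangle f_1(v)+\langle f_2(u),v\rangle f_2(v)\right)^c$ 15) $\tilde R(u^v,v^c)v^c=\left(-\frac14\langle f_2(u),v\rangle\langle b_1-a_2,v\rangle+\langle f_1(u),v\rangle\langle a_1,v\rangle+\frac12\langle f_2(u),v\rangle\langle b_1+a_2,v\rangle\right)e_1^v+\left(-\frac14\langle f_1(u),v\rangle\langle a_2-b_1,v\rangle+\langle f_2(u),v\rangle\langle b_2,v\rangle+\frac12\langle f_1(u),v\rangle\langle b_1+a_2,v\rangle\right)e_2^v+\frac34\langle f_1(u),v\rangle(f_1(v))^v+\frac34\langle f_2(u),v\rangle(f_2(v))^v$ 16) $\tilde R(u^v,v^v)v^v=\tilde R(u^c,u^v)u^v=0$ 17) $\tilde R(u^c,e_1^c)e_1^c=\left(-\frac14f_1^2(u)-\langle a_1,u\rangle a_1+\frac14\langle u,f_1(a_2+b_1)-2f_2(a_1)\rangle e_2+\frac14\langle u,b_1-3a_2\rangle(a_2+b_1)\right)^c$ 18) $\tilde R(u^c,e_1^v)e_1^v=\left(-\frac14\langle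 u,f_1(a_1)\rangle e_1+\frac14\langle u,f_1(b_1)-2f_2(a_1)\rangle e_2+\frac14\langle u,b_1-3a_2\rangle(a_2+b_1)-\langle a_1,u\rangle a_1-\frac14f_1^2(u)\right)^c$ 19) $\tilde R(u^c,e_2^c)e_2^c=\left(-\frac14f_2^2(u)-\langle b_2,u\rangle b_2+\frac14\langle u,f_2(b_1+a_2)-2f_1(b_2)\rangle e_1+\frac14\langle u,a_2-3b_1\rangle(a_2+b_1)\right)^c$ 20) $\tilde R(u^c,e_2^v)e_2^v=\left(-\frac14f_2^2(u)-\langle b_2,u\rangle b_2+\frac14\langle u,f_2(a_2)-2f_1(b_2)\rangle e_1-\frac14\langle u,f_2(b_2)\rangle e_2+\frac14\langle u,a_2-3b_1\rangle(a_2+b_1)\right)^c$ 21) $\tilde R(u^v,e_1^c)e_1^c=\left(-\frac12\left(\langle u,f_1(a_1)\rangle e_1+\langle u,f_2(a_1)\rangle e_2\right)-\frac34\left(\langle a_1,u\rangle a_1+\langle a_2,u\rangle a_2\right)\right)^v$ 22) $\tilde R(u^v,e_1^v)e_1^v=\frac14\left(\langle u,f_1(a_2+b_1)-2f_2(a_1)\rangle e_2+\langle b_1,u\rangle b_1+\langle a_1,u\rangle a_1-f_1^2(u)\right)^v$ 23) $\tilde R(u^v,e_2^c)e_2^c=\left(-\frac12\left(\langle u,f_1(b_2)\rangle e_1+\langle u,f_2(b_2)\rangle e_2\right)-\frac34\left(\langle b_1,u\rangle b_1+\langle b_2,u\rangle b_2\right)\right)^v$ 24) $\tilde R(u^v,e_2^v)e_2^v=\frac14\left(\langle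 u,f_2(a_2+b_1)-2f_1(b_2)\rangle e_1+\langle a_2,u\rangle a_2+\langle b_2,u\rangle b_2-f_2^2(u)\right)^v$ 25) $\tilde R(e_2^c,u^v)u^v=-\frac34\Big(\left(\langle a_1,u\rangle\langle b_1,u\rangle+\langle a_2,u\rangle\langle b_2,u\rangle\right)e_1^c+\left(\langle b_1,u\rangle^2+\langle b_2,u\rangle^2\right)e_2^c+\langle b_1,u\rangle(f_1(u))^c+\langle b_2,u\rangle(f_2(u))^c\Big)$ 26) $\tilde R(e_2^c,u^c)u^c=\left(\frac12\langle b_2,u\rangle\langle b_1-a_2,u\rangle+\frac14\langle f_1(u),f_2(u)\rangle-\langle a_1,u\rangle\langle b_1,u\rangle-\frac12\langle b_2,u\rangle\langle b_1+a_2,u\rangle\right)e_1^c+\left(-\frac12\langle b_1,u\rangle\langle b_1+a_2,u\rangle-\langle b_2,u\rangle^2+\frac14\langle b_1+a_2,u\rangle\langle a_2-b_1,u\rangle+\frac14\|f_2(u)\|^2\right)e_2^c-\frac14\langle a_2+3b_1,u\rangle(f_1(u))^c-\langle b_2,u\rangle(f_2(u))^c$ 27) $\tilde R(e_2^v,u^v)u^v=\frac14\left(\langle a_1,u\rangle\langle a_2,u\rangle+\langle b_1,u\rangle\langle b_2,u\rangle+\langle f_1(u),f_2(u)\rangle\right)e_1^v+\frac14\left(\langle a_2,u\rangle^2+\langle b_2,u\rangle^2+\|f_2(u)\|^2\right)e_2^v$ 28) $\tilde R(e_2^v,u^c)u^c=\left(\frac12\langle b_2,u\rangle\langle b_1-a_2,u\rangle+\frac14\langle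 f_1(u),f_2(u)\rangle-\langle a_1,u\rangle\langle b_1,u\rangle-\frac12\langle b_2,u\rangle\langle b_1+a_2,u\rangle\right)e_1^v+\left(-\frac12\langle b_1,u\rangle\langle b_1+a_2,u\rangle-\langle b_2,u\rangle^2+\frac14\langle b_1+a_2,u\rangle\langle a_2-b_1,u\rangle+\frac14\|f_2(u)\|^2\right)e_2^v-\frac14\langle a_2+3b_1,u\rangle(f_1(u))^v-\langle b_2,u\rangle(f_2(u))^v$ 29) $\tilde R(e_1^v,u^v)u^v=\frac14\left(\langle a_1,u\rangle^2+\langle b_1,u\rangle^2+\|f_1(u)\|^2\right)e_1^v+\frac14\left(\langle a_1,u\rangle\langle a_2,u\rangle+\langle b_1,u\rangle\langle b_2,u\rangle+\langle f_1(u),f_2(u)\rangle\right)e_2^v$ 30) $\tilde R(e_1^v,u^c)u^c=\left(-\frac12\langle a_2,u\rangle\langle b_1+a_2,u\rangle-\langle a_1,u\rangle^2+\frac14\langle b_1+a_2,u\rangle\langle b_1-a_2,u\rangle+\frac14\|f_1(u)\|^2\right)e_1^v+\left(\frac12\langle a_1,u\rangle\langle a_2-b_1,u\rangle+\frac14\langle f_1(u),f_2(u)\rangle-\langle a_2,u\rangle\langle b_2,u\rangle-\frac12\langle a_1,u\rangle\langle b_1+a_2,u\rangle\right)e_2^v-\frac14\langle b_1+3a_2,u\rangle(f_2(u))^v-\langle a_1,u\rangle(f_1(u))^v$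
   Context: $G$ is a connected $n$-dimensional real Lie group with Lie algebra $\mathfrak g$ (left-invariant vector fields) such that $\mathfrak g'=[\mathfrak g,\mathfrak g]$ has dimension $2$ (equivalently, the commutator subgroup is two-dimensional). $g$ is a left-invariant Riemannian metric on $G$, with induced inner product $\langle\cdot,\cdot\rangle$ on $\mathfrak g$ and $\|\cdot\|^2=\langle\cdot,\cdot\rangle$. $\{e_1,e_2\}$ is an orthonormal basis of $\mathfrak g'$ and $\mathcal P$ is the $(n-2)$-dimensional orthogonal complement of $\mathfrak g'$ in $\mathfrak g$. The vectors $a_1,a_2,b_1,b_2\in\mathcal P$ and skew-symmetric linear maps $f_1,f_2:\mathcal P\to\mathcal P$ are uniquely determined by: for all $u,v\in\mathcal P$, $[u,e_1]=\langle a_1,u\rangle e_1+\langle a_2,u\rangle e_2$, $[u,e_2]=\langle b_1,u\rangle e_1+\langle b_2,u\rangle e_2$, $[u,v]=\langle f_1(u),v\rangle e_1+\langle f_2(u),v\rangle e_2$. Here $f_i^2=f_i\circ f_i$. $TG$ is a Lie group with the tangent map $T\mu$ of the multiplication $\mu$ as product. For a vector field $X$ on $G$, the vertical lift $X^v$ is the infinitesimal generator on $TG$ of the flow $y\mapsto y+tX(x)$, $y\in T_xG$, and the complete lift $X^c$ is the infinitesimal generator of $T\phi_t$, where $\phi_t$ is the (local) flow of $X$. Lifts of left-invariant fields are left-invariant on $TG$, with $[X^c,Y^c]=[X,Y]^c$, $[X^c,Y^v]=[X,Y]^v$, $[X^v,Y^v]=0$. The lifted left-invariant metric $\tilde g$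 on $TG$ is defined by $\tilde g(X^c,Y^c)=\tilde g(X^v,Y^v)=g(X,Y)$, $\tilde g(X^c,Y^v)=0$ for $X,Y\in\mathfrak g$. With $\widetilde\nabla$ the Levi-Civita connection of $\tilde g$, $\tilde R(A,B)C=\widetilde\nabla_A\widetilde\nabla_BC-\widetilde\nabla_B\widetilde\nabla_AC-\widetilde\nabla_{[A,B]}C$. *)

(* Defs.v *)
From HB Require Import structures.
From mathcomp Require Export all_boot all_order all_algebra reals.

Set Implicit Arguments.
Unset Strict Implicit.
Unset Printing Implicit Defensive.

Import Order.TTheory GRing.Theory Num.Theory.
#[global] Open Scope ring_scope.

(* A Lie group with a left-invariant metric is represented by its Lie algebra *)
(* of left-invariant vector fields (a vector space with a bracket br) and the *)
(* inner product ip that the metric induces on it.                            *)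

Definition is_lie_bracket (R : realType) (V : lmodType R)
    (br : {bilinear V -> V -> V}) : Prop :=
  (forall x, br x x = 0) /\
  (forall x y z, br x (br y z) + br y (br z x) + br z (br x y) = 0).

Definition derived_algebra (R : realType) (V : vectType R)
    (br : {bilinear V -> V -> V}) : {vspace V} :=
  <<[seq br x y | x <- vbasis {:V}, y <- vbasis {:V}]>>%VS.

(* The derived algebra is the smallest subspace containing all brackets, not  *)
(* only those of the vectors of the chosen basis.                             *)
Lemma derived_algebra_sub (R : realType) (V : vectType R)
    (br : {bilinear V -> V -> V}) (W : {vspace V}) :
  (derived_algebra br <= W)%VS <-> (forall x y, br x y \in W).
Proof.
split=> [sW x y | brW]; last by apply/span_subvP => _ /allpairsP[[x y] [_ _ ->]].
rewrite (coord_vbasis (memvf x)) (coord_vbasis (memvf y)).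
rewrite linear_sumlz rpred_sum // => i _.
rewrite linear_sumr rpred_sum // => j _.
rewrite linearZr_LR /= rpredZ // linearZl_LR /= rpredZ //.
apply: (subvP sW); apply/memv_span.
by apply: allpairs_f; apply: mem_nth; rewrite size_tuple.
Qed.

(* A skew-symmetric linear map P -> P, given as a function on the ambient     *)
(* space whose values outside P are irrelevant.                               *)
Definition is_skew_endo (R : realType) (V : vectType R)
    (ip : {dot V for idfun}) (P : {vspace V}) (f : V -> V) : Prop :=
  [/\ forall x, x \in P -> f x \in P,
      forall (k : R) x y, x \in P -> y \in P -> f (k *: x + y) = k *: f x + f y
    & forall x y, x \in P -> y \in P -> ip (f x) y = - ip x (f y)].

(* The Levi-Civita connection of a left-invariant metric, on left-invariant   *)
(* fields: by the Koszul formula nabla x y is again left-invariant, and since *)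
(* <y, z> is a constant function the compatibility condition                  *)
(* x<y, z> = <nabla x y, z> + <y, nabla x z> has left-hand side 0.            *)
Definition is_levi_civita (R : realType) (V : lmodType R)
    (br : {bilinear V -> V -> V}) (ip : {dot V for idfun})
    (nabla : {bilinear V -> V -> V}) : Prop :=
  (forall x y, nabla x y - nabla y x = br x y) /\
  (forall x y z, ip (nabla x y) z + ip y (nabla x z) = 0).

Definition riemann (R : realType) (V : lmodType R)
    (br nabla : {bilinear V -> V -> V}) (x y z : V) : V :=
  nabla x (nabla y z) - nabla y (nabla x z) - nabla (br x y) z.

(* The Lie algebra of left-invariant fields on the tangent group TG is        *)
(* V * V, the pair (x, y) standing for the field x^c + y^v.                   *)
Section TangentGroup.
Variables (R : realType) (V : lmodType R).

Definition complete_lift (x : V) : V * V := (x, 0).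
Definition vertical_lift (x : V) : V * V := (0, x).

Section Bracket.
Variable br : {bilinear V -> V -> V}.

Definition lift_bracket (p q : V * V) : V * V :=
  (br p.1 q.1, br p.1 q.2 + br p.2 q.1).

Fact lift_bracket_bilinear : bilinear_for *:%R *:%R lift_bracket.
Proof.
split=> z k x y; congr (_, _) => /=.
- by rewrite linearPl.
- by rewrite !linearPl scalerDr addrACA.
- by rewrite linearPr.
- by rewrite !linearPr scalerDr addrACA.
Qed.
HB.instance Definition _ :=
  bilinear_isBilinear.Build R (V * V)%type (V * V)%type (V * V)%type
    *:%R *:%R lift_bracket lift_bracket_bilinear.

Lemma lift_bracket_cc x y :
  lift_bracket (complete_lift x) (complete_lift y) = complete_lift (br x y).
Proof. by rewrite /lift_bracket /= linear0r linear0l addr0. Qed.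

Lemma lift_bracket_cv x y :
  lift_bracket (complete_lift x) (vertical_lift y) = vertical_lift (br x y).
Proof. by rewrite /lift_bracket /= linear0r linear0l addr0. Qed.

Lemma lift_bracket_vv x y :
  lift_bracket (vertical_lift x) (vertical_lift y) = 0.
Proof. by rewrite /lift_bracket /= !linear0l linear0r addr0. Qed.

Lemma lift_bracket_lie : is_lie_bracket br -> is_lie_bracket lift_bracket.
Proof.
case=> br0 jac.
have anti x y : br x y = - br y x.
  apply/eqP; rewrite -addr_eq0; apply/eqP.
  by have := br0 (x + y); rewrite linearDl !linearDr /= !br0 add0r addr0.
split=> [[x x']|[x x'] [y y'] [z z']]; congr (_, _) => //=.
  by rewrite (anti x' x) subrr.
rewrite !linearDr /= [LHS](AC (3*3*3) ((1*5*9)*(2*6*7)*(3*4*8))) /=.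
by rewrite !jac !addr0.
Qed.

End Bracket.

Section Metric.
Variable ip : {dot V for idfun}.

Definition lift_metric (p q : V * V) : R := ip p.1 q.1 + ip p.2 q.2.

Fact lift_metric_bilinear : bilinear_for *%R (idfun \; *%R) lift_metric.
Proof.
split=> z k x y; rewrite /lift_metric /=.
  by rewrite !linearPl mulrDr addrACA.
by rewrite !linearPr mulrDr addrACA.
Qed.
HB.instance Definition _ :=
  bilinear_isBilinear.Build R (V * V)%type (V * V)%type R
    *%R (idfun \; *%R) lift_metric lift_metric_bilinear.

Fact lift_metric_sym p q : lift_metric p q = (-1) ^+ false * lift_metric q p.
Proof.
by rewrite mul1r /lift_metric (hermC ip p.1) (hermC ip p.2) /= !mul1r.
Qed.
HB.instance Definition _ :=
  isHermitianSesquilinear.Build R (V * V)%type false idfun lift_metric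
    lift_metric_sym.

Fact lift_metric_gt0 p : p != 0 -> 0 < lift_metric p p.
Proof.
have ge0 x : 0 <= ip x x.
  have [->|/(@neq0_dnorm_gt0 _ _ _ ip)/ltW//] := eqVneq x 0.
  by rewrite linear0l.
case: p => x y nz; rewrite /lift_metric /=.
have [x0|/(@neq0_dnorm_gt0 _ _ _ ip) x_gt0] := eqVneq x 0; last first.
  by rewrite ltr_pwDl.
rewrite ltr_wpDl // neq0_dnorm_gt0 //.
by apply: contra nz => /eqP ->; rewrite x0.
Qed.
HB.instance Definition _ :=
  isDotProduct.Build R (V * V)%type lift_metric lift_metric_gt0.

Lemma lift_metric_cc x y :
  lift_metric (complete_lift x) (complete_lift y) = ip x y.
Proof. by rewrite /lift_metric /= linear0l addr0. Qed.

Lemma lift_metric_vv x y :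
  lift_metric (vertical_lift x) (vertical_lift y) = ip x y.
Proof. by rewrite /lift_metric /= linear0l add0r. Qed.

Lemma lift_metric_cv x y :
  lift_metric (complete_lift x) (vertical_lift y) = 0.
Proof. by rewrite /lift_metric /= linear0l linear0r addr0. Qed.

End Metric.

End TangentGroup.

Notation "x ^c" := (complete_lift x) : ring_scope.
Notation "x ^v" := (vertical_lift x)
  (at level 2, left associativity, format "x ^v") : ring_scope.

(* Main.v *)
From HB Require Import structures.
Require Import Defs.
From mathcomp Require Import ring lra.

Set Implicit Arguments.
Unset Strict Implicit.
Unset Printing Implicit Defensive.

Import Order.TTheory GRing.Theory Num.Theory.

(** Write ad_x^t for the adjoint of z |-> [x, z], that is
<<
   <ad_x^t y, z> = <[x, z], y>.
>>
    On left-invariant fields the Koszul formula is purely algebraic, and on the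
    tangent group it separates into complete and vertical parts:
<<
   nabla x^c y^c =   1/2 ([x, y] - ad_x^t y - ad_y^t x)^c
   nabla x^c y^v =   1/2 ([x, y] - ad_x^t y)^v
   nabla x^v y^c =   1/2 ([x, y] - ad_y^t x)^v
   nabla x^v y^v = - 1/2 (ad_x^t y + ad_y^t x)^c
>>
    So the lifted connection, and with it the curvature, is known once the
    bracket and ad^t are known on e1, e2 and on P.

    The data a_i, b_i, f_i give all brackets except [e1, e2], and the first
    point is that this one vanishes.  For every z let tau z be the trace of ad_z
    on the ideal g'.  As a trace, tau kills commutators, hence it is 0 on g';
    but tau e1 and tau e2 are, up to sign, the coordinates of [e1, e2].

    Since [x, z] lies in the span of e1 and e2, there are linear maps A1, A2
    with [x, z] = <A1 x, z> e1 + <A2 x, z> e2, and therefore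
<<
   ad_x^t y = <y, e1> A1 x + <y, e2> A2 x.
>>
    In particular ad_x^t y = 0 for y in P, while A_i e1 = - a_i, A_i e2 = - b_i
    and A_i p = f_i p + <a_i, p> e1 + <b_i, p> e2 for p in P.

    Each curvature identity is then a finite computation: both sides become
    linear combinations of lifts of e1, e2, a_i, b_i and of images under the
    f_i, and applying an arbitrary linear form turns the comparison into a
    polynomial identity between real numbers, which holds by the symmetry of
    the inner product and the skewness of f1 and f2.

    The connection is computed in nabla_cc, nabla_cv, nabla_vc and nabla_vv;
    derived_abelian gives [e1, e2] = 0, and br_coord the maps A1 and A2, which
    are instances of coord_map. *)

(** * Inner products *)

Section InnerProduct.
Variables (R : realType) (V : lmodType R) (ip : {dot V for idfun}).
Implicit Types (k : R) (x y z : V).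

Lemma ipC x y : ip x y = ip y x.
Proof. by rewrite (hermC ip x) mul1r. Qed.

Lemma ip0l x : ip 0 x = 0.
Proof. exact: linear0l. Qed.

Lemma ipDl x y z : ip (x + y) z = ip x z + ip y z.
Proof. exact: linearDl. Qed.

Lemma ipDr x y z : ip x (y + z) = ip x y + ip x z.
Proof. exact: linearDr. Qed.

Lemma ipNl x y : ip (- x) y = - ip x y.
Proof. exact: linearNl. Qed.

Lemma ipNr x y : ip x (- y) = - ip x y.
Proof. exact: linearNr. Qed.

Lemma ipZl k x y : ip (k *: x) y = k * ip x y.
Proof. exact: linearZl_LR. Qed.

Lemma ipZr k x y : ip x (k *: y) = k * ip x y.
Proof. exact: linearZr_LR. Qed.

Definition ipE := (ip0l, ipDl, ipDr, ipNl, ipNr, ipZl, ipZr).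

Lemma ip_inj x y : (forall z, ip x z = ip y z) -> x = y.
Proof.
move=> eq_xy; apply/eqP; rewrite -subr_eq0; apply: contraT.
by move=> /(@neq0_dnorm_gt0 _ _ _ ip); rewrite ipDl ipNl eq_xy subrr ltxx.
Qed.

(** Reduces an identity between vectors to one between scalars.  The form phi
    is kept opaque, rather than being the pairing with a vector, so that the
    scalars phi x are not affected by rules that rewrite inner products. *)
Lemma eq_by_linear_form x y :
  (forall phi : V -> R,
     phi 0 = 0 -> {morph phi : a b / a + b} -> {morph phi : a / - a} ->
     (forall k a, phi (k *: a) = k * phi a) -> phi x = phi y) ->
  x = y.
Proof.
move=> eq_phi; apply: ip_inj => z; apply: (eq_phi (ip ^~ z)).
- exact: ip0l.
- by move=> a b; rewrite ipDl.
- by move=> a; rewrite ipNl.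
- by move=> k a; rewrite ipZl.
Qed.

Lemma ip_skew_diag (P : {pred V}) (f : V -> V) p :
  (forall x y, x \in P -> y \in P -> ip (f x) y = - ip x (f y)) ->
  p \in P -> ip (f p) p = 0.
Proof. by move=> skew pP; have := skew p p pP pP; rewrite (ipC p) => ?; lra. Qed.

End InnerProduct.

Section Bilinear.
Variables (R : realType) (V : lmodType R) (B : {bilinear V -> V -> V}).
Implicit Types (k : R) (x y z : V).

Lemma bilin0l x : B 0 x = 0.
Proof. exact: linear0l. Qed.

Lemma bilin0r x : B x 0 = 0.
Proof. exact: linear0r. Qed.

Lemma bilinDl x y z : B (x + y) z = B x z + B y z.
Proof. exact: linearDl. Qed.

Lemma bilinDr x y z : B x (y + z) = B x y + B x z.
Proof. exact: linearDr. Qed.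

Lemma bilinNl x y : B (- x) y = - B x y.
Proof. exact: linearNl. Qed.

Lemma bilinNr x y : B x (- y) = - B x y.
Proof. exact: linearNr. Qed.

Lemma bilinZl k x y : B (k *: x) y = k *: B x y.
Proof. exact: linearZl_LR. Qed.

Lemma bilinZr k x y : B x (k *: y) = k *: B x y.
Proof. exact: linearZr_LR. Qed.

Definition bilinE :=
  (bilin0l, bilin0r, bilinDl, bilinDr, bilinNl, bilinNr, bilinZl, bilinZr).

Lemma lie_bracket_anti : is_lie_bracket B -> forall x y, B x y = - B y x.
Proof.
case=> B0 _ x y; apply/eqP; rewrite -addr_eq0; apply/eqP.
by have := B0 (x + y); rewrite bilinDl !bilinDr !B0 add0r addr0.
Qed.

End Bilinear.

(** * The Levi-Civita connection of the lifted metric *)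

Section Koszul.
Variables (R : realType) (V : lmodType R).
Variables (br : {bilinear V -> V -> V}) (ip : {dot V for idfun}).
Variable nabla : {bilinear V -> V -> V}.
Hypothesis LC : is_levi_civita br ip nabla.

(** The usual derivation: without derivatives of the constant functions <y, z>,
    metric compatibility for the three cyclic arrangements of x, y, z gives the
    right-hand side once the brackets are replaced by torsion-freeness. *)
Lemma koszul x y z :
  2 * ip (nabla x y) z = ip (br x y) z - ip (br y z) x + ip (br z x) y.
Proof.
case: LC => torsion compat.
have := (compat x y z, compat y x z, compat z x y).
rewrite -!torsion !(ipE ip) (ipC ip y) (ipC ip x) (ipC ip x (nabla z y)).
by case=> [[]]; lra.
Qed.

End Koszul.

Section LiftLinear.
Variables (R : realType) (V : lmodType R).
Implicit Types (k : R) (x y : V).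

Lemma clift0 : (0 : V)^c = 0.
Proof. by []. Qed.

Lemma cliftD x y : (x + y)^c = x^c + y^c.
Proof. by apply: injective_projections; rewrite /= ?addr0. Qed.

Lemma cliftN x : (- x)^c = - x^c.
Proof. by apply: injective_projections; rewrite /= ?oppr0. Qed.

Lemma cliftZ k x : (k *: x)^c = k *: x^c.
Proof. by apply: injective_projections; rewrite /= ?scaler0. Qed.

Lemma vlift0 : (0 : V)^v = 0.
Proof. by []. Qed.

Lemma vliftD x y : (x + y)^v = x^v + y^v.
Proof. by apply: injective_projections; rewrite /= ?addr0. Qed.

Lemma vliftN x : (- x)^v = - x^v.
Proof. by apply: injective_projections; rewrite /= ?oppr0. Qed.

Lemma vliftZ k x : (k *: x)^v = k *: x^v.
Proof. by apply: injective_projections; rewrite /= ?scaler0. Qed.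

Definition liftE :=
  (clift0, cliftD, cliftN, cliftZ, vlift0, vliftD, vliftN, vliftZ).

Lemma lift_bracket_vc (br : {bilinear V -> V -> V}) x y :
  lift_bracket br x^v y^c = (br x y)^v.
Proof. by rewrite /lift_bracket /= !linear0l add0r. Qed.

End LiftLinear.

Section LiftConnection.
Variables (R : realType) (V : lmodType R).
Variables (br : {bilinear V -> V -> V}) (ip : {dot V for idfun}).
Variable nabla : {bilinear (V * V)%type -> (V * V)%type -> (V * V)%type}.
Hypothesis LC : is_levi_civita (lift_bracket br) (lift_metric ip) nabla.
Hypothesis br_anti : forall x y, br x y = - br y x.
Variable adt : V -> V -> V.
Hypothesis adtP : forall x y z, ip (adt x y) z = ip (br x z) y.

(** The Koszul formula determines the connection, because the lifted metric is
    nondegenerate. *)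
Lemma lift_nablaP p q (r : V * V) :
  (forall w, 2 * lift_metric ip r w =
     lift_metric ip (lift_bracket br p q) w
     - lift_metric ip (lift_bracket br q w) p
     + lift_metric ip (lift_bracket br w p) q) ->
  nabla p q = r.
Proof.
move=> rP; apply: (@ip_inj _ _ (lift_metric ip)) => w.
have := koszul LC p q w; rewrite -rP.
by move/mulfI; apply; rewrite pnatr_eq0.
Qed.

Let anti x y z : ip (br x y) z = - ip (br y x) z.
Proof. by rewrite br_anti ipNl. Qed.

(** In the four lemmas below the right-hand side is a combination of lifts and
    not the lift of a combination: rewriting from the inside of an iterated
    covariant derivative then stops until linearity has been used. *)
Lemma nabla_cc x y :
  nabla x^c y^c = (1 / 2) *: ((br x y)^c - (adt x y)^c - (adt y x)^c).
Proof.
rewrite -!(cliftN, cliftD, cliftZ).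
apply: lift_nablaP => -[z t]; rewrite /lift_metric /= !linear0l !linear0r.
by rewrite !(ipE ip) !adtP !(anti z); field.
Qed.

Lemma nabla_cv x y :
  nabla x^c y^v = (1 / 2) *: ((br x y)^v - (adt x y)^v).
Proof.
rewrite -!(vliftN, vliftD, vliftZ).
apply: lift_nablaP => -[z t]; rewrite /lift_metric /= !linear0l !linear0r.
by rewrite !(ipE ip) !adtP !(anti t); field.
Qed.

Lemma nabla_vc x y :
  nabla x^v y^c = (1 / 2) *: ((br x y)^v - (adt y x)^v).
Proof.
rewrite -!(vliftN, vliftD, vliftZ).
apply: lift_nablaP => -[z t]; rewrite /lift_metric /= !linear0l !linear0r.
by rewrite !(ipE ip) !adtP; field.
Qed.

Lemma nabla_vv x y :
  nabla x^v y^v = - (1 / 2) *: ((adt x y)^c + (adt y x)^c).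
Proof.
rewrite -!(cliftN, cliftD, cliftZ).
apply: lift_nablaP => -[z t]; rewrite /lift_metric /= !linear0l !linear0r.
by rewrite !(ipE ip) !adtP !(anti z); field.
Qed.

End LiftConnection.

(** * Lie algebras with a two-dimensional derived algebra *)

Section Frame.
Variables (R : realType) (V : vectType R).
Variables (br : {bilinear V -> V -> V}) (ip : {dot V for idfun}).
Hypothesis lie : is_lie_bracket br.
Variables e1 e2 : V.
Hypothesis span_e : derived_algebra br = <<[:: e1; e2]>>%VS.
Hypotheses (ip11 : ip e1 e1 = 1) (ip22 : ip e2 e2 = 1) (ip12 : ip e1 e2 = 0).

Let br_anti := lie_bracket_anti lie.

Let ip21 : ip e2 e1 = 0.
Proof. by rewrite ipC. Qed.

Lemma mem_derived x y : br x y \in derived_algebra br.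
Proof. exact: (derived_algebra_sub br _).1. Qed.

Lemma derived_coord z :
  z \in derived_algebra br -> z = ip z e1 *: e1 + ip z e2 *: e2.
Proof.
rewrite span_e span_cons span_seq1.
case/memv_addP=> _ /vlineP[k ->] [_ /vlineP[l ->] ->].
by rewrite !(ipE ip) ip11 ip12 ip21 ip22 !mulr1 !mulr0 addr0 add0r.
Qed.

(** The trace of ad z on the derived algebra, as e1, e2 is orthonormal.  The
    codomain is the vector space R^o so that the kernel is a subspace. *)
Definition ad_trace (z : V) : R^o := ip (br z e1) e1 + ip (br z e2) e2.

Fact ad_trace_linear : linear ad_trace.
Proof.
move=> k x y; rewrite /ad_trace !(bilinE br) !(ipE ip) /GRing.scale /=; ring.
Qed.
HB.instance Definition _ :=
  GRing.isLinear.Build R V R^o *:%R ad_trace ad_trace_linear.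

(** By the Jacobi identity ad [x, y] is the commutator of ad x and ad y, both of
    which preserve the derived algebra. *)
Lemma ad_trace_br x y : ad_trace (br x y) = 0.
Proof.
have jac z : br (br x y) z = br x (br y z) - br y (br x z).
  have := lie.2 x y z; rewrite (br_anti z x) (br_anti z (br x y)) !(bilinE br).
  by move/eqP; rewrite subr_eq0 => /eqP <-.
have adE z : br z e1 = ip (br z e1) e1 *: e1 + ip (br z e1) e2 *: e2 /\
             br z e2 = ip (br z e2) e1 *: e1 + ip (br z e2) e2 *: e2.
  by split; apply/derived_coord/mem_derived.
have [x1 x2] := adE x; have [y1 y2] := adE y.
rewrite /ad_trace !jac x1 x2 y1 y2 !(bilinE br) x1 x2 y1 y2 !(ipE ip).
by rewrite ip11 ip12 ip21 ip22; ring.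
Qed.

(** The traces of ad e1 and ad e2 are the e2-coordinate of [e1, e2] and minus its
    e1-coordinate.  Both vanish, since the trace is 0 on every bracket and the
    derived algebra is spanned by brackets. *)
Lemma derived_abelian : br e1 e2 = 0.
Proof.
have trace0 z : z \in derived_algebra br -> ad_trace z = 0.
  have /subvP sub : (derived_algebra br <= lker (linfun ad_trace))%VS.
    apply/derived_algebra_sub => x y.
    by rewrite memv_ker lfunE /= ad_trace_br.
  by move/sub; rewrite memv_ker lfunE => /eqP.
have e1D : e1 \in derived_algebra br by rewrite span_e memv_span ?mem_head.
have e2D : e2 \in derived_algebra br.
  by rewrite span_e memv_span // inE mem_head orbT.
have br0 := lie.1.
have := trace0 _ e1D; rewrite /ad_trace br0 ip0l add0r => coord2.
have := trace0 _ e2D; rewrite /ad_trace br0 ip0l addr0 br_anti ipNl.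
move/eqP; rewrite oppr_eq0 => /eqP coord1.
by rewrite [LHS]derived_coord ?mem_derived // coord1 coord2 !scale0r addr0.
Qed.

Variable P : {vspace V}.
Hypothesis PE : P = orthov ip (derived_algebra br).

Lemma ortho_frameP x : reflect (ip x e1 = 0 /\ ip x e2 = 0) (x \in P).
Proof.
rewrite PE; apply: (iffP mem_orthovP) => [x0 | [x1 x2] z].
  by split; apply: x0; rewrite span_e memv_span // !inE eqxx ?orbT.
move/derived_coord=> z_eq; suff: ip x z = 0 by [].
by rewrite z_eq !(ipE ip) x1 x2 !mulr0 addr0.
Qed.

Lemma ortho_e1 p : p \in P -> ip p e1 = 0.
Proof. by case/ortho_frameP. Qed.

Lemma ortho_e2 p : p \in P -> ip p e2 = 0.
Proof. by case/ortho_frameP. Qed.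

Definition ortho_proj x := x - ip x e1 *: e1 - ip x e2 *: e2.

Lemma ortho_proj_mem x : ortho_proj x \in P.
Proof.
apply/ortho_frameP; rewrite !(ipE ip) ip11 ip12 ip21 ip22.
by split; ring.
Qed.

Lemma ortho_projK x : x = ip x e1 *: e1 + ip x e2 *: e2 + ortho_proj x.
Proof. by rewrite addrC /ortho_proj -[X in X + _]addrA -opprD subrK. Qed.

Lemma ip_ortho_projr p x : p \in P -> ip p (ortho_proj x) = ip p x.
Proof.
by move=> pP; rewrite !(ipE ip) (ortho_e1 pP) (ortho_e2 pP); ring.
Qed.

Lemma ortho_proj_e1 : ortho_proj e1 = 0.
Proof. by rewrite /ortho_proj ip11 ip12 scale1r scale0r subr0 subrr. Qed.

Lemma ortho_proj_e2 : ortho_proj e2 = 0.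
Proof. by rewrite /ortho_proj ip22 ip21 scale1r scale0r subr0 subrr. Qed.

Lemma ortho_proj_id p : p \in P -> ortho_proj p = p.
Proof.
by move=> pP; rewrite /ortho_proj ortho_e1 // ortho_e2 // !scale0r !subr0.
Qed.

(** With f, a, b equal to f_i, a_i, b_i, this is the skew map A_i such that
    <A_i x, y> is the coordinate of [x, y] along e_i. *)
Definition coord_map (f : V -> V) (a b x : V) : V :=
  f (ortho_proj x) + ip a x *: e1 + ip b x *: e2
  - ip x e1 *: a - ip x e2 *: b.

Section CoordMap.
Variables (f : V -> V) (a b : V).
Hypothesis skew_f : is_skew_endo ip P f.
Hypotheses (aP : a \in P) (bP : b \in P).

Let f0 : f 0 = 0.
Proof.
have [_ lin _] := skew_f; have := lin (-1) 0 0 (mem0v P) (mem0v P).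
by rewrite scaler0 add0r scaleN1r addNr.
Qed.

Lemma coord_map_e1 : coord_map f a b e1 = - a.
Proof.
rewrite /coord_map ortho_proj_e1 f0 ip11 ip12 ortho_e1 // ortho_e1 //.
by rewrite !(scale0r, scale1r, oppr0, add0r, addr0).
Qed.

Lemma coord_map_e2 : coord_map f a b e2 = - b.
Proof.
rewrite /coord_map ortho_proj_e2 f0 ip22 ip21 ortho_e2 // ortho_e2 //.
by rewrite !(scale0r, scale1r, oppr0, add0r, addr0).
Qed.

Lemma coord_map_ortho p :
  p \in P -> coord_map f a b p = f p + ip a p *: e1 + ip b p *: e2.
Proof.
move=> pP; rewrite /coord_map ortho_proj_id // ortho_e1 // ortho_e2 //.
by rewrite !scale0r !subr0.
Qed.

(** Evaluated on the components of x and y: since f takes values in P, it sees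
    only the component of y in P. *)
Lemma ip_coord_map x y :
  ip (coord_map f a b x) y =
  ip (f (ortho_proj x)) (ortho_proj y)
  + ip a (ortho_proj x) * ip y e1 + ip b (ortho_proj x) * ip y e2
  - ip x e1 * ip a (ortho_proj y) - ip x e2 * ip b (ortho_proj y).
Proof.
have [f_mem _ _] := skew_f.
rewrite !ip_ortho_projr ?f_mem ?ortho_proj_mem //.
by rewrite !(ipE ip) (ipC ip e1) (ipC ip e2).
Qed.

End CoordMap.

Variables a1 a2 b1 b2 : V.
Hypotheses (a1P : a1 \in P) (a2P : a2 \in P) (b1P : b1 \in P) (b2P : b2 \in P).
Variables f1 f2 : V -> V.
Hypotheses (skew_f1 : is_skew_endo ip P f1) (skew_f2 : is_skew_endo ip P f2).
Hypothesis br_e1 :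
  forall p, p \in P -> br p e1 = ip a1 p *: e1 + ip a2 p *: e2.
Hypothesis br_e2 :
  forall p, p \in P -> br p e2 = ip b1 p *: e1 + ip b2 p *: e2.
Hypothesis br_ortho : forall p q, p \in P -> q \in P ->
  br p q = ip (f1 p) q *: e1 + ip (f2 p) q *: e2.

(** By bilinearity it is enough to compare the two sides on e1, e2 and P, where
    the bracket is given, except for [e1, e2] = 0, which is derived_abelian. *)
Lemma br_coord x y :
  br x y = ip (coord_map f1 a1 b1 x) y *: e1
           + ip (coord_map f2 a2 b2 x) y *: e2.
Proof.
rewrite !ip_coord_map // [in LHS](ortho_projK x) [in LHS](ortho_projK y).
move: (ortho_proj x) (ortho_proj_mem x) => p pP.
move: (ortho_proj y) (ortho_proj_mem y) => q qP.
rewrite !(bilinE br) !lie.1 derived_abelian (br_anti e2 e1) derived_abelian.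
rewrite (br_anti e1 q) (br_anti e2 q).
rewrite !br_e1 // !br_e2 // br_ortho //.
apply: (@eq_by_linear_form _ _ ip) => phi phi0 phiD phiN phiZ.
by rewrite !(phi0, phiD, phiN, phiZ); ring.
Qed.

Definition ad_transpose x y : V :=
  ip y e1 *: coord_map f1 a1 b1 x + ip y e2 *: coord_map f2 a2 b2 x.

Lemma ad_transposeP x y z : ip (ad_transpose x y) z = ip (br x z) y.
Proof.
rewrite br_coord /ad_transpose.
move: (coord_map f1 a1 b1 x) (coord_map f2 a2 b2 x) => A1x A2x.
by rewrite !(ipE ip) (ipC ip e1) (ipC ip e2); ring.
Qed.

Lemma ad_transpose_e1 x : ad_transpose x e1 = coord_map f1 a1 b1 x.
Proof. by rewrite /ad_transpose ip11 ip12 scale1r scale0r addr0. Qed.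

Lemma ad_transpose_e2 x : ad_transpose x e2 = coord_map f2 a2 b2 x.
Proof. by rewrite /ad_transpose ip22 ip21 scale1r scale0r add0r. Qed.

Lemma ad_transpose_ortho x p : p \in P -> ad_transpose x p = 0.
Proof.
by move=> pP; rewrite /ad_transpose ortho_e1 // ortho_e2 // !scale0r addr0.
Qed.

End Frame.

(** * The curvature identities *)

(** A curvature on lifts contains one bracket, which is evaluated first, and
    covariant derivatives nested two deep, hence two rounds of rewriting.  Here
    brT and adtT are the tables of the bracket and of ad^t on e1, e2 and P,
    nablaT expresses the connection by them, fT expands f1 and f2 over sums, and
    ipT brings the remaining inner products to a normal form. *)
Ltac curvature ip nabla nablaT brT adtT fT ipT :=
  rewrite /riemann /= ?(lift_bracket_cc, lift_bracket_cv,
                        lift_bracket_vc, lift_bracket_vv);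
  rewrite ?brT //; rewrite ?liftE ?(bilinE nabla);
  do 2! [rewrite ?nablaT; rewrite ?brT //; rewrite ?adtT //;
         rewrite ?(opprK, subr0, sub0r, add0r, addr0, scaler0);
         rewrite ?liftE; rewrite ?(bilinE nabla)];
  rewrite ?fT // ?liftE ?(ipE ip);
  let phi := fresh "phi" in
  let phi0 := fresh "phi0" in let phiD := fresh "phiD" in
  let phiN := fresh "phiN" in let phiZ := fresh "phiZ" in
  apply: (@eq_by_linear_form _ _ (lift_metric ip)) => phi phi0 phiD phiN phiZ;
  rewrite ?(phi0, phiD, phiN, phiZ) ?ipT /=; by field.

Theorem lemma4p4 (R : realType) (V : vectType R)
    (br : {bilinear V -> V -> V}) (ip : {dot V for idfun})
    (hbr : is_lie_bracket br)
    (hdim : \dim (derived_algebra br) = 2%N)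
    (e1 e2 : V)
    (hbasis : basis_of (derived_algebra br) [:: e1; e2])
    (horth : orthonormal ip [:: e1; e2])
    (P : {vspace V}) (hP : P = orthov ip (derived_algebra br))
    (a1 a2 b1 b2 : V)
    (ha1 : a1 \in P) (ha2 : a2 \in P) (hb1 : b1 \in P) (hb2 : b2 \in P)
    (f1 f2 : V -> V)
    (hf1 : is_skew_endo ip P f1) (hf2 : is_skew_endo ip P f2)
    (hadj1 : forall u, u \in P -> br u e1 = ip a1 u *: e1 + ip a2 u *: e2)
    (hadj2 : forall u, u \in P -> br u e2 = ip b1 u *: e1 + ip b2 u *: e2)
    (hbrP : forall u v, u \in P -> v \in P ->
       br u v = ip (f1 u) v *: e1 + ip (f2 u) v *: e2)
    (nabla : {bilinear (V * V)%type -> (V * V)%type -> (V * V)%type})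
    (hnabla : is_levi_civita (lift_bracket br) (lift_metric ip) nabla) :
  let Rt := riemann (lift_bracket br) nabla in
  forall u v, u \in P -> v \in P ->
  (* 1 *)
  Rt e1^c e2^c e2^c =
    (- ip a1 b2 + 1 / 4 * ip (a2 + b1) (a2 + b1)) *: e1^c
    - (1 / 4) *: (2 *: f1 b2 - f2 a2 - f2 b1)^c
  /\ (* 2 *)
  Rt e1^c e2^v e2^v =
    (- ip a1 b2 + 1 / 4 * ip a2 a2) *: e1^c
    - (1 / 4 * ip (2 *: b1 + a2) b2) *: e2^c
    - (1 / 4) *: (2 *: f1 b2 - f2 a2)^c
  /\ (* 3 *)
  Rt e1^c e1^v e1^v =
    - (1 / 4) *: ((3 * ip a1 a1) *: e1^c
                  + ip (b1 + 2 *: a2) a1 *: e2^c + (f1 a1)^c)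
  /\ (* 4 *)
  Rt e1^v e2^v e2^v =
    (- ip a1 b2 + 1 / 4 * ip (a2 + b1) (a2 + b1)) *: e1^v
    - (1 / 4) *: (2 *: f1 b2 - f2 a2 - f2 b1)^v
  /\ (* 5 *)
  Rt e1^v e2^c e2^c =
    (- ip a1 b2 + 1 / 4 * ip b1 b1) *: e1^v
    - (1 / 4 * ip (b1 + 2 *: a2) b2) *: e2^v
    - (1 / 2) *: (f1 b2)^v
  /\ (* 6 *)
  Rt e2^c e2^v e2^v =
    - (1 / 4) *: (ip (2 *: b1 + a2) b2 *: e1^c
                  + (3 * ip b2 b2) *: e2^c + (f2 b2)^c)
  /\ (* 7 *)
  Rt e2^c e1^v e1^v =
    - (1 / 4 * ip a1 (b1 + 2 *: a2)) *: e1^c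
    + (1 / 4 * ip b1 b1 - ip a1 b2) *: e2^c
    + ((1 / 4) *: f1 b1 - (1 / 2) *: f2 a1)^c
  /\ (* 8 *)
  Rt e2^c e2^v e2^v =
    - (1 / 4 * ip b2 (a2 + 2 *: b1)) *: e1^c
    - (3 / 4 * ip b2 b2) *: e2^c
    - (1 / 4) *: (f2 b2)^c
  /\ (* 9 *)
  Rt e2^v e2^c e2^c =
    - (1 / 4 * ip (2 *: a2 + b1) b2) *: e1^v
    - (3 / 4 * ip b2 b2) *: e2^v
    - (1 / 2) *: (f2 b2)^v
  /\ (* 10 *)
  Rt e2^v e1^v e1^v =
    (1 / 4 * ip (a2 + b1) (a2 + b1) - ip a1 b2) *: e2^v
    + (1 / 4) *: (f1 a2)^v + (1 / 4) *: (f1 b1)^v - (1 / 2) *: (f2 a1)^v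
  /\ (* 11 *)
  Rt e2^v e1^c e1^c =
    - (1 / 4 * ip a1 (a2 + 2 *: b1)) *: e1^v
    + (1 / 4 * ip a2 a2 - ip a1 b2) *: e2^v
    - (1 / 2) *: (f2 a1)^v
  /\ (* 12 *)
  Rt e2^c e1^c e1^c =
    (- ip a1 b2 + 1 / 4 * ip (a2 + b1) (a2 + b1)) *: e2^c
    - (1 / 4) *: (2 *: f2 a1 - f1 a2 - f1 b1)^c
  /\ (* 13 *)
  Rt u^c v^c v^c =
    (1 / 4 * ip (f2 u) v * ip (b1 + 3 *: a2) v + ip (f1 u) v * ip a1 v) *: e1^c
    + (1 / 4 * ip (f1 u) v * ip (a2 + 3 *: b1) v
       + ip (f2 u) v * ip b2 v) *: e2^c
    + (3 / 4) *: (ip (f1 u) v *: f1 v + ip (f2 u) v *: f2 v)^c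
  /\ (* 14 *)
  Rt u^c v^v v^v =
    (3 / 4 * (ip (f1 u) v * ip a1 v + ip (f2 u) v * ip a2 v)) *: e1^c
    + (3 / 4 * (ip (f1 u) v * ip b1 v + ip (f2 u) v * ip b2 v)) *: e2^c
    + (3 / 4) *: (ip (f1 u) v *: f1 v + ip (f2 u) v *: f2 v)^c
  /\ (* 15 *)
  Rt u^v v^c v^c =
    (- (1 / 4) * ip (f2 u) v * ip (b1 - a2) v + ip (f1 u) v * ip a1 v
     + 1 / 2 * ip (f2 u) v * ip (b1 + a2) v) *: e1^v
    + (- (1 / 4) * ip (f1 u) v * ip (a2 - b1) v + ip (f2 u) v * ip b2 v
       + 1 / 2 * ip (f1 u) v * ip (b1 + a2) v) *: e2^v
    + (3 / 4 * ip (f1 u) v) *: (f1 v)^v + (3 / 4 * ip (f2 u) v) *: (f2 v)^v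
  /\ (* 16 *)
  (Rt u^v v^v v^v = 0 /\ Rt u^c u^v u^v = 0)
  /\ (* 17 *)
  Rt u^c e1^c e1^c =
    (- (1 / 4) *: f1 (f1 u) - ip a1 u *: a1
     + (1 / 4 * ip u (f1 (a2 + b1) - 2 *: f2 a1)) *: e2
     + (1 / 4 * ip u (b1 - 3 *: a2)) *: (a2 + b1))^c
  /\ (* 18 *)
  Rt u^c e1^v e1^v =
    (- (1 / 4 * ip u (f1 a1)) *: e1
     + (1 / 4 * ip u (f1 b1 - 2 *: f2 a1)) *: e2
     + (1 / 4 * ip u (b1 - 3 *: a2)) *: (a2 + b1)
     - ip a1 u *: a1 - (1 / 4) *: f1 (f1 u))^c
  /\ (* 19 *)
  Rt u^c e2^c e2^c =
    (- (1 / 4) *: f2 (f2 u) - ip b2 u *: b2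
     + (1 / 4 * ip u (f2 (b1 + a2) - 2 *: f1 b2)) *: e1
     + (1 / 4 * ip u (a2 - 3 *: b1)) *: (a2 + b1))^c
  /\ (* 20 *)
  Rt u^c e2^v e2^v =
    (- (1 / 4) *: f2 (f2 u) - ip b2 u *: b2
     + (1 / 4 * ip u (f2 a2 - 2 *: f1 b2)) *: e1
     - (1 / 4 * ip u (f2 b2)) *: e2
     + (1 / 4 * ip u (a2 - 3 *: b1)) *: (a2 + b1))^c
  /\ (* 21 *)
  Rt u^v e1^c e1^c =
    (- (1 / 2) *: (ip u (f1 a1) *: e1 + ip u (f2 a1) *: e2)
     - (3 / 4) *: (ip a1 u *: a1 + ip a2 u *: a2))^v
  /\ (* 22 *)
  Rt u^v e1^v e1^v =
    (1 / 4) *: (ip u (f1 (a2 + b1) - 2 *: f2 a1) *: e2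
                + ip b1 u *: b1 + ip a1 u *: a1 - f1 (f1 u))^v
  /\ (* 23 *)
  Rt u^v e2^c e2^c =
    (- (1 / 2) *: (ip u (f1 b2) *: e1 + ip u (f2 b2) *: e2)
     - (3 / 4) *: (ip b1 u *: b1 + ip b2 u *: b2))^v
  /\ (* 24 *)
  Rt u^v e2^v e2^v =
    (1 / 4) *: (ip u (f2 (a2 + b1) - 2 *: f1 b2) *: e1
                + ip a2 u *: a2 + ip b2 u *: b2 - f2 (f2 u))^v
  /\ (* 25 *)
  Rt e2^c u^v u^v =
    - (3 / 4) *: ((ip a1 u * ip b1 u + ip a2 u * ip b2 u) *: e1^c
                  + (ip b1 u ^+ 2 + ip b2 u ^+ 2) *: e2^c
                  + ip b1 u *: (f1 u)^c + ip b2 u *: (f2 u)^c)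
  /\ (* 26 *)
  Rt e2^c u^c u^c =
    (1 / 2 * ip b2 u * ip (b1 - a2) u + 1 / 4 * ip (f1 u) (f2 u)
     - ip a1 u * ip b1 u - 1 / 2 * ip b2 u * ip (b1 + a2) u) *: e1^c
    + (- (1 / 2) * ip b1 u * ip (b1 + a2) u - ip b2 u ^+ 2
       + 1 / 4 * ip (b1 + a2) u * ip (a2 - b1) u
       + 1 / 4 * ip (f2 u) (f2 u)) *: e2^c
    - (1 / 4 * ip (a2 + 3 *: b1) u) *: (f1 u)^c - ip b2 u *: (f2 u)^c
  /\ (* 27 *)
  Rt e2^v u^v u^v =
    (1 / 4 * (ip a1 u * ip a2 u + ip b1 u * ip b2 u
              + ip (f1 u) (f2 u))) *: e1^v
    + (1 / 4 * (ip a2 u ^+ 2 + ip b2 u ^+ 2 + ip (f2 u) (f2 u))) *: e2^v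
  /\ (* 28 *)
  Rt e2^v u^c u^c =
    (1 / 2 * ip b2 u * ip (b1 - a2) u + 1 / 4 * ip (f1 u) (f2 u)
     - ip a1 u * ip b1 u - 1 / 2 * ip b2 u * ip (b1 + a2) u) *: e1^v
    + (- (1 / 2) * ip b1 u * ip (b1 + a2) u - ip b2 u ^+ 2
       + 1 / 4 * ip (b1 + a2) u * ip (a2 - b1) u
       + 1 / 4 * ip (f2 u) (f2 u)) *: e2^v
    - (1 / 4 * ip (a2 + 3 *: b1) u) *: (f1 u)^v - ip b2 u *: (f2 u)^v
  /\ (* 29 *)
  Rt e1^v u^v u^v =
    (1 / 4 * (ip a1 u ^+ 2 + ip b1 u ^+ 2 + ip (f1 u) (f1 u))) *: e1^v
    + (1 / 4 * (ip a1 u * ip a2 u + ip b1 u * ip b2 u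
                + ip (f1 u) (f2 u))) *: e2^v
  /\ (* 30 *)
  Rt e1^v u^c u^c =
    (- (1 / 2) * ip a2 u * ip (b1 + a2) u - ip a1 u ^+ 2
     + 1 / 4 * ip (b1 + a2) u * ip (b1 - a2) u
     + 1 / 4 * ip (f1 u) (f1 u)) *: e1^v
    + (1 / 2 * ip a1 u * ip (a2 - b1) u + 1 / 4 * ip (f1 u) (f2 u)
       - ip a2 u * ip b2 u - 1 / 2 * ip a1 u * ip (b1 + a2) u) *: e2^v
    - (1 / 4 * ip (b1 + 3 *: a2) u) *: (f2 u)^v - ip a1 u *: (f1 u)^v.
Proof.
have span_e : derived_algebra br = <<[:: e1; e2]>>%VS.
  by case/andP: hbasis => /eqP.
have [ip11 ip22 ip12] : [/\ ip e1 e1 = 1, ip e2 e2 = 1 & ip e1 e2 = 0].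
  move: horth; rewrite /orthonormal /= !andbT.
  by case/andP=> /andP[/eqP ? /eqP ?] /eqP ?.
have br_anti := lie_bracket_anti hbr.
have br0 := hbr.1.
have br12 := derived_abelian hbr span_e ip11 ip22 ip12.
have br21 : br e2 e1 = 0 by rewrite br_anti br12 oppr0.
have br_e1l p : p \in P -> br e1 p = - (ip a1 p *: e1 + ip a2 p *: e2).
  by move=> pP; rewrite br_anti hadj1.
have br_e2l p : p \in P -> br e2 p = - (ip b1 p *: e1 + ip b2 p *: e2).
  by move=> pP; rewrite br_anti hadj2.
have brT := (br0, br12, br21, br_e1l, br_e2l, hadj1, hadj2, hbrP).
pose adt := ad_transpose ip e1 e2 a1 a2 b1 b2 f1 f2.
have adtP : forall x y z, ip (adt x y) z = ip (br x z) y.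
  exact: (ad_transposeP hbr span_e ip11 ip22 ip12 hP ha1 ha2 hb1 hb2 hf1 hf2
                        hadj1 hadj2 hbrP).
have adt_e1 x : adt x e1 = coord_map ip e1 e2 f1 a1 b1 x.
  exact: ad_transpose_e1.
have adt_e2 x : adt x e2 = coord_map ip e1 e2 f2 a2 b2 x.
  exact: ad_transpose_e2.
have adt_ortho x p : p \in P -> adt x p = 0.
  exact: (ad_transpose_ortho span_e ip11 ip22 ip12 hP).
have adt_11 : adt e1 e1 = - a1.
  by rewrite adt_e1 (coord_map_e1 span_e ip11 ip22 ip12 hP hf1 ha1 hb1).
have adt_21 : adt e2 e1 = - b1.
  by rewrite adt_e1 (coord_map_e2 span_e ip11 ip22 ip12 hP hf1 ha1 hb1).
have adt_12 : adt e1 e2 = - a2.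
  by rewrite adt_e2 (coord_map_e1 span_e ip11 ip22 ip12 hP hf2 ha2 hb2).
have adt_22 : adt e2 e2 = - b2.
  by rewrite adt_e2 (coord_map_e2 span_e ip11 ip22 ip12 hP hf2 ha2 hb2).
have adt_ortho1 p :
    p \in P -> adt p e1 = f1 p + ip a1 p *: e1 + ip b1 p *: e2.
  by rewrite adt_e1; apply: (coord_map_ortho span_e ip11 ip22 ip12 hP).
have adt_ortho2 p :
    p \in P -> adt p e2 = f2 p + ip a2 p *: e1 + ip b2 p *: e2.
  by rewrite adt_e2; apply: (coord_map_ortho span_e ip11 ip22 ip12 hP).
(* Only the values of ad^t on e1, e2 and P enter the computation. *)
clearbody adt; clear adt_e1 adt_e2.
have nablaT := (nabla_cc hnabla br_anti adtP, nabla_cv hnabla br_anti adtP,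
                nabla_vc hnabla adtP, nabla_vv hnabla br_anti adtP).
have adtT := (adt_11, adt_12, adt_21, adt_22, adt_ortho1, adt_ortho2,
              adt_ortho).
have [f1_mem f1_lin f1_skew] := hf1; have [f2_mem f2_lin f2_skew] := hf2.
have f1D x y : x \in P -> y \in P -> f1 (x + y) = f1 x + f1 y.
  by move=> xP yP; rewrite -[x in LHS]scale1r f1_lin // scale1r.
have f2D x y : x \in P -> y \in P -> f2 (x + y) = f2 x + f2 y.
  by move=> xP yP; rewrite -[x in LHS]scale1r f2_lin // scale1r.
have fT := (f1D, f2D).
move=> Rt u v uP vP; rewrite {}/Rt.
have [f1u f2u] := (f1_mem u uP, f2_mem u uP).
(* Normal forms of inner products: a1, a2, b1, b2 in this order and before u;
   f1 and f2 are moved from u to the vectors a_i and b_i, and two of them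
   applied to u are placed on different sides. *)
have f1u_ip x : x \in P ->
    (ip (f1 u) x = - ip u (f1 x)) * (ip x (f1 u) = - ip u (f1 x)).
  by move=> xP; rewrite (ipC ip x) f1_skew.
have f2u_ip x : x \in P ->
    (ip (f2 u) x = - ip u (f2 x)) * (ip x (f2 u) = - ip u (f2 x)).
  by move=> xP; rewrite (ipC ip x) f2_skew.
have f1_diag p : p \in P -> ip (f1 p) p = 0.
  exact: ip_skew_diag f1_skew.
have f2_diag p : p \in P -> ip (f2 p) p = 0.
  exact: ip_skew_diag f2_skew.
have ipT :=
  (ipC ip b1 a1, ipC ip b2 a1, ipC ip a2 a1, ipC ip b1 a2, ipC ip b2 a2,
   ipC ip b2 b1, ipC ip u a1, ipC ip u a2, ipC ip u b1, ipC ip u b2,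
   f1_diag u uP, f2_diag u uP, f1_diag v vP, f2_diag v vP,
   f1u_ip a1 ha1, f1u_ip a2 ha2, f1u_ip b1 hb1, f1u_ip b2 hb2,
   f2u_ip a1 ha1, f2u_ip a2 ha2, f2u_ip b1 hb1, f2u_ip b2 hb2,
   ipC ip (f2 u) (f1 u), f1_skew _ _ f1u uP, f1_skew _ _ f2u uP,
   f2_skew _ _ f1u uP, f2_skew _ _ f2u uP).
by do !apply: conj; curvature ip nabla nablaT brT adtT fT ipT.
Qed.
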